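(* There exist sequences $(\alpha_n)$ in $(0,\infty)$ with $0<\liminf\alpha_n\le\limsup\alpha_n<\infty$ and $(\rho_n)$ in $(0,1)$ such that the overlap of uniformly random shortest paths between vertices $1$ and $2$ in $G^{(1)}_n$ and $G^{(2)}_n$, sampled from the optimal coupling, has variance bounded away from zero as $n\to\infty$.
   Context: $q_n=\alpha_n\log n/n$. Let $G^{(1)}_n\sim\mathcal G(n,q_n)$ on $\{1,\dots,n\}$ and obtain $G^{(2)}_n$ by independently, for each unordered vertex pair, with probability $1-\rho_n$ resampling its adjacency as a fresh Bernoulli$(q_n)$. Given the two graphs, let $P^{(1)},P^{(2)}$ be shortest paths from $1$ to $2$ in $G^{(1)}_n$, $G^{(2)}_n$ respectively, jointly sampled from a coupling of the uniform distributions on the sets of shortest $1$–$2$ paths of the two graphs that minimizes the expected Hamming distance (size of the symmetric difference of edge sets). The overlap is $|P^{(1)}\cap P^{(2)}|/\sqrt{|P^{(1)}||P^{(2)}|}$, where $|P|$ is the number of edges and the intersection counts common edges; the variance is over all randomness (graphs and coupling). *)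

(* Defs.v *)
From HB Require Import structures.
From mathcomp Require Import all_boot all_order all_algebra.
From mathcomp Require Import boolp reals ereal sequences exp.

Set Implicit Arguments.
Unset Strict Implicit.
Unset Printing Implicit Defensive.

Import Order.TTheory GRing.Theory Num.Theory.
Local Open Scope ring_scope.
Local Open Scope set_scope.

Definition edge (V : finType) := {e : {set V} | (#|e| == 2)%N}.

Definition graph (V : finType) := {set edge V}.

Definition adj (V : finType) (G : graph V) (u v : V) : bool :=
  [exists e : edge V, (e \in G) && (val e == [set u; v])].

Definition walk_edges (V : finType) (s : V) (p : seq V) : {set edge V} :=
  [set e : edge V |
    has (fun uv : V * V => val e == [set uv.1; uv.2]) (zip (s :: p) p)].

(* A path from s to t is identified with its set of edges, which determines
   its sequence of vertices s :: p. *)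
Definition is_st_path (V : finType) (G : graph V) (s t : V)
    (P : {set edge V}) : Prop :=
  exists p : seq V,
    [/\ path (adj G) s p, last s p = t, uniq (s :: p) & P = walk_edges s p].

Definition is_shortest_path (V : finType) (G : graph V) (s t : V)
    (P : {set edge V}) : Prop :=
  is_st_path G s t P /\
  forall Q : {set edge V}, is_st_path G s t Q -> (#|P| <= #|Q|)%N.

Definition shortest_paths (V : finType) (G : graph V) (s t : V) :
    {set {set edge V}} :=
  [set P : {set edge V} | `[< is_shortest_path G s t P >]].

(* If s and t are disconnected in G there is no path to sample; the sampled
   path is then taken to be the empty edge set. *)
Definition sampled_paths (V : finType) (G : graph V) (s t : V) :
    {set {set edge V}} :=
  if shortest_paths G s t == set0 then [set set0] else shortest_paths G s t.

Definition uniform (R : realType) (T : finType) (A : {set T}) (x : T) : R :=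
  if x \in A then #|A|%:R^-1 else 0.

Definition is_coupling (R : realType) (T : finType) (mu nu : T -> R)
    (pi : T -> T -> R) : Prop :=
  [/\ forall x y, 0 <= pi x y,
      forall x, \sum_(y : T) pi x y = mu x
    & forall y, \sum_(x : T) pi x y = nu y].

Definition hamming (T : finType) (A B : {set T}) : nat :=
  #|(A :\: B) :|: (B :\: A)|.

Definition expected_hamming (R : realType) (T : finType)
    (pi : {set T} -> {set T} -> R) : R :=
  \sum_(A : {set T}) \sum_(B : {set T}) pi A B * (hamming A B)%:R.

Definition is_optimal_coupling (R : realType) (T : finType)
    (mu nu : {set T} -> R) (pi : {set T} -> {set T} -> R) : Prop :=
  is_coupling mu nu pi /\
  forall pi' : {set T} -> {set T} -> R,
    is_coupling mu nu pi' -> expected_hamming pi <= expected_hamming pi'.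

Definition path_coupling (R : realType) (V : finType) :=
  graph V -> graph V -> {set edge V} -> {set edge V} -> R.

Definition is_optimal_path_coupling (R : realType) (V : finType) (s t : V)
    (kappa : path_coupling R V) : Prop :=
  forall G1 G2 : graph V,
    is_optimal_coupling (uniform R (sampled_paths G1 s t))
                        (uniform R (sampled_paths G2 s t)) (kappa G1 G2).

(* The value is 0 when P or Q is empty, since 0^-1 = 0. *)
Definition overlap (R : realType) (T : finType) (P Q : {set T}) : R :=
  #|P :&: Q|%:R / Num.sqrt (#|P|%:R * #|Q|%:R).

(* The law of a random subset containing each element independently with
   probability p. *)
Definition bernoulli_subset (R : realType) (T : finType) (p : R)
    (A : {set T}) : R :=
  \prod_(x : T) (if x \in A then p else 1 - p).

(* U is the set of resampled pairs and F the graph of fresh adjacencies. *)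
Definition resample (V : finType) (G U F : graph V) : graph V :=
  (G :\: U) :|: (F :&: U).

(* An outcome is a tuple (G1, U, F, P1, P2), the second graph being
   resample G1 U F. *)
Definition outcome (V : finType) :=
  (graph V * graph V * graph V * {set edge V} * {set edge V})%type.

Definition outcome_law (R : realType) (V : finType) (q rho : R)
    (kappa : path_coupling R V) (w : outcome V) : R :=
  let: (G1, U, F, P1, P2) := w in
  bernoulli_subset q G1 * bernoulli_subset (1 - rho) U * bernoulli_subset q F
    * kappa G1 (resample G1 U F) P1 P2.

Definition outcome_overlap (R : realType) (V : finType) (w : outcome V) : R :=
  let: (_, _, _, P1, P2) := w in overlap R P1 P2.

Definition expectation (R : realType) (T : finType) (law : T -> R)
    (X : T -> R) : R :=
  \sum_(w : T) law w * X w.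

Definition variance (R : realType) (T : finType) (law : T -> R)
    (X : T -> R) : R :=
  expectation law (fun w => (X w - expectation law X) ^+ 2).

(* The vertices labelled 1, ..., n are represented by 'I_n, with n = m.+2. *)
Definition vertex1 (m : nat) : 'I_m.+2 := @Ordinal m.+2 0 isT.
Definition vertex2 (m : nat) : 'I_m.+2 := @Ordinal m.+2 1 isT.

(* This lies in [0, 1] for all large n when the sequence a is bounded. *)
Definition edge_prob (R : realType) (a : R) (n : nat) : R :=
  a * ln n%:R / n%:R.

Definition overlap_variance (R : realType) (a rho : R) (m : nat)
    (kappa : path_coupling R 'I_m.+2) : R :=
  variance (outcome_law (edge_prob a m.+2) rho kappa)
           (outcome_overlap R (V := 'I_m.+2)).

(* Main.v *)
Require Import Defs.
From HB Require Import structures.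
From mathcomp Require Import all_boot all_order all_algebra.
From mathcomp Require Import boolp reals ereal sequences exp.
From mathcomp Require Import ring lra zify.

(* Let d = n q be the mean degree.  The parameters are tuned so that, for some
   k close to log n / log log n, the expected number d^k / n of 1-2 paths of
   length k is about 1/64, while a given path of the first graph survives in
   the second one with probability r^k = 1/2.

   Given that a fixed path p of length k is present in the first graph, the
   expected number of other 1-2 paths of length at most k in either graph is
   small.  Indeed a walk may follow p at no cost, but it then has at most two
   continuations instead of d, so the walks leaving p weigh at most
   (d + 2)^l / n.  A first moment bound over p therefore gives, with probability
   bounded below, that p is the unique shortest path of both graphs, and then
   the overlap is 1.  It also gives, with probability bounded below, that p is
   the unique shortest path of the first graph, while it is broken and all
   paths are longer than k in the second graph.  In that case an overlap above
   9/10 would force a path of length at most 5k/4 sharing at least 3k/4 edges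
   with p; weighting the edges of p by d in the same walk bound shows that such
   near copies are rare.  So the overlap takes values separated by 1/10 with
   probabilities bounded below, whatever the couplings are. *)

Set Implicit Arguments.
Unset Strict Implicit.
Unset Printing Implicit Defensive.

Import Order.TTheory GRing.Theory Num.Theory.
Local Open Scope ring_scope.

(** * Edge sets of simple walks *)

Section WalkEdges.
Variable V : finType.
Implicit Types (x y : V) (p : seq V) (G : graph V).

Lemma mem_walk_edges_cons x y p (e : edge V) :
  (e \in walk_edges x (y :: p)) = (val e == [set x; y]) || (e \in walk_edges y p).
Proof. by rewrite !inE. Qed.

Lemma walk_edges_nil x : walk_edges x [::] = set0.
Proof. by apply/setP => e; rewrite !inE. Qed.

Lemma walk_edges_vertices x p (e : edge V) :
  e \in walk_edges x p -> {subset val e <= x :: p}.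
Proof.
elim: p x => [|y p IHp] x; first by rewrite walk_edges_nil inE.
rewrite mem_walk_edges_cons => /orP[/eqP -> u|/IHp sub u /sub up].
  by rewrite !inE => /orP[]/eqP ->; rewrite eqxx ?orbT.
by rewrite inE up orbT.
Qed.

Lemma pair_edge x y : x != y -> {e : edge V | val e = [set x; y]}.
Proof.
move=> xy; have h : #|[set x; y]| == 2 by rewrite cards2 xy.
by exists (exist _ [set x; y] h).
Qed.

Lemma head_edge_notin x y p (e : edge V) : uniq (x :: y :: p) ->
  val e = [set x; y] -> e \notin walk_edges y p.
Proof.
move=> /andP[xp _] ve; apply/negP => /walk_edges_vertices sub.
by move: xp; rewrite sub // ve !inE eqxx.
Qed.

Lemma walk_edges_consU x y p (e : edge V) : val e = [set x; y] ->
  walk_edges x (y :: p) = e |: walk_edges y p.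
Proof.
by move=> ve; apply/setP => e'; rewrite mem_walk_edges_cons !inE -ve val_eqE.
Qed.

Lemma card_walk_edges x p : uniq (x :: p) -> #|walk_edges x p| = size p.
Proof.
elim: p x => [|y p IHp] x up; first by rewrite walk_edges_nil cards0.
have [|e ve] := @pair_edge x y.
  by move: up; rewrite /= !inE; case: eqP.
rewrite (walk_edges_consU p ve) cardsU1 (head_edge_notin up ve) IHp //.
by move: up => /= /andP[].
Qed.

Lemma path_walk_edges G x p : path (adj G) x p -> walk_edges x p \subset G.
Proof.
elim: p x => [|y p IHp] x; first by rewrite walk_edges_nil sub0set.
move=> /= /andP[/fintype.existsP[e /andP[eG /eqP ve]] /IHp sub].
by rewrite (walk_edges_consU p ve) subUset sub1set eG.
Qed.

Lemma walk_edges_path G x p : uniq (x :: p) -> walk_edges x p \subset G ->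
  path (adj G) x p.
Proof.
elim: p x => [|y p IHp] x // up.
have [|e ve] := @pair_edge x y.
  by move: up; rewrite /= !inE; case: eqP.
rewrite (walk_edges_consU p ve) subUset sub1set => /andP[eG sub] /=.
rewrite IHp ?andbT //; last by move: up => /= /andP[].
by apply/fintype.existsP; exists e; rewrite eG ve eqxx.
Qed.

Lemma adjC G : symmetric (adj G).
Proof. by move=> x y; rewrite /adj; under eq_existsb do rewrite setUC. Qed.

Lemma adj_walk_edges_cons x y p u v : adj (walk_edges x (y :: p)) u v ->
  [|| (u == x) && (v == y), (u == y) && (v == x) | adj (walk_edges y p) u v].
Proof.
move=> /fintype.existsP[e /andP[]]; rewrite mem_walk_edges_cons.
move=> /orP[/eqP ve|ep] /eqP veuv; last first.
  by apply/or3P; apply: Or33; apply/fintype.existsP; exists e; rewrite ep veuv eqxx.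
have := valP e; rewrite /= veuv cards2 => uv.
have uxy : u \in [set x; y] by rewrite -ve veuv !inE eqxx.
have vxy : v \in [set x; y] by rewrite -ve veuv !inE eqxx orbT.
move: uxy vxy uv; rewrite !inE.
by do 2![case/orP=> /eqP->]; rewrite ?eqxx ?orbT.
Qed.

Lemma adj_walk_edges_mem x p u v : adj (walk_edges x p) u v -> u \in x :: p.
Proof.
move=> /fintype.existsP[e /andP[/walk_edges_vertices sub /eqP ve]].
by apply: sub; rewrite ve !inE eqxx.
Qed.

(** The term [(u == x)] records that the start has degree at most 1, which leaves room in the
    induction for the edge added at [y] when a vertex is put in front. *)
Lemma walk_edges_degree x p u : uniq (x :: p) ->
  (#|[set v | adj (walk_edges x p) u v]| + (u == x) <= 2)%N.
Proof.
elim: p x => [|y p IHp] x up.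
  rewrite (_ : [set _ | _] = set0) ?cards0; first by case: eqP.
  apply/setP=> v; rewrite !inE; apply/(introF idP).
  rewrite walk_edges_nil => /fintype.existsP[e].
  by rewrite inE.
have up' : uniq (y :: p) by move: up => /= /andP[].
have xy : x != y by move: up; rewrite /= !inE; case: eqP.
have sub : [set v | adj (walk_edges x (y :: p)) u v] \subset
   [set v | (u == x) && (v == y)] :|: [set v | (u == y) && (v == x)]
     :|: [set v | adj (walk_edges y p) u v].
  apply/subsetP=> v; rewrite !inE => /adj_walk_edges_cons.
  by case/or3P=> ->; rewrite ?orbT.
have c1 : (#|[set v | (u == x) && (v == y)]| <= (u == x))%N.
  case: eqP => _ /=.
    by rewrite (_ : [set _ | _] = [set y]) ?cards1 //; apply/setP=> v; rewrite !inE.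
  by rewrite (_ : [set _ | _] = set0) ?cards0 //; apply/setP=> v; rewrite !inE.
have c2 : (#|[set v | (u == y) && (v == x)]| <= (u == y))%N.
  case: eqP => _ /=.
    by rewrite (_ : [set _ | _] = [set x]) ?cards1 //; apply/setP=> v; rewrite !inE.
  by rewrite (_ : [set _ | _] = set0) ?cards0 //; apply/setP=> v; rewrite !inE.
have := leq_trans (subset_leq_card sub) (leq_trans (leq_card_setU _ _)
  (leq_add (leq_card_setU _ _) (leqnn _))).
have := IHp y up'; move: c1 c2.
have [ux|ux] := eqVneq u x.
  rewrite (_ : [set v | adj (walk_edges y p) u v] = set0) ?cards0.
    by rewrite ux (negPf xy); lia.
  apply/setP=> v; rewrite !inE; apply/(introF idP)=> /adj_walk_edges_mem.
  by rewrite ux; move: up => /= /andP[/negPf ->].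
by case: eqP; lia.
Qed.

Lemma path_walk_edges_behead x y p z p' : x \notin z :: p' ->
  path (adj (walk_edges x (y :: p))) z p' -> path (adj (walk_edges y p)) z p'.
Proof.
elim: p' z => //= u p' IHp z xp' /andP[azu pp'].
rewrite IHp ?andbT //; last by move: xp'; rewrite inE negb_or => /andP[].
move: xp'; rewrite !inE !negb_or => /and3P[xz xu _].
case/or3P: (adj_walk_edges_cons azu) => // /andP[/eqP e1 /eqP e2].
  by rewrite e1 eqxx in xz.
by rewrite e2 eqxx in xu.
Qed.

(* A simple path inside another one with the same endpoints is forced at each
   step: the only unused edge at the current vertex is the next one. *)
Lemma walk_edges_sub_eq x p p' : uniq (x :: p) -> uniq (x :: p') ->
  last x p = last x p' -> path (adj (walk_edges x p)) x p' -> p' = p.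
Proof.
elim: p x p' => [|y p IHp] x p' up up'.
  case: p' up' => //= y p' /andP[xp' _] xl _.
  by move: xp'; rewrite xl mem_last.
have up1 : uniq (y :: p) by move: up => /= /andP[].
have xp : x \notin y :: p by move: up => /= /andP[].
have xy : x != y by move: xp; rewrite /= !inE; case: eqP.
case: p' up' => [|y' p'] up' /=.
  by move=> lx; move: xp; rewrite -lx mem_last.
have xp' : x \notin y' :: p' by move: up' => /= /andP[].
have up1' : uniq (y' :: p') by move: up' => /= /andP[].
move=> eql /andP[axy' pp'].
have yy' : y' = y.
  case/or3P: (adj_walk_edges_cons axy').
  - by case/andP=> _ /eqP.
  - by rewrite (negPf xy).
  - by move/adj_walk_edges_mem; rewrite (negPf xp).
move: eql pp' up1' xp'; rewrite yy' => eql pp' up1' xp'; congr cons.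
apply: (IHp y) => //.
exact: path_walk_edges_behead pp'.
Qed.

End WalkEdges.

(** * Weighted sums over walks *)

Lemma sum_tuple_cons (R : nmodType) (T : finType) l (P : pred (seq T)) (F : seq T -> R) :
  \sum_(p : l.+1.-tuple T | P p) F p =
  \sum_(y : T) \sum_(p : l.-tuple T | P (y :: p)) F (y :: p).
Proof.
rewrite pair_big_dep /=.
rewrite (reindex (fun yp : T * l.-tuple T => [tuple of yp.1 :: yp.2])) /=.
  by apply: eq_bigl => -[y p].
exists (fun p : l.+1.-tuple T => (thead p, [tuple of behead p])) => [[y p] _|p _].
  by congr pair; apply: val_inj.
by rewrite [p in RHS]tuple_eta.
Qed.

Section WalkSums.
Variables (R : realFieldType) (V : finType) (A : rel V) (q z : R) (t : V).
Hypotheses (q0 : 0 <= q) (z0 : 0 <= z).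
Hypothesis A_sym : symmetric A.
Hypothesis A_deg : forall x, (#|[set y | A x y]| <= 2)%N.

Definition walk_weight (w : V -> V -> R) x p : R :=
  \prod_(e <- zip (x :: p) p) w e.1 e.2.

Lemma walk_weight_cons w x y p :
  walk_weight w x (y :: p) = w x y * walk_weight w y p.
Proof. by rewrite /walk_weight /= big_cons. Qed.

(** Since [A] has degree at most 2, [D] bounds the total weight of the steps into a vertex. Rivals
    will use [z = 1], near copies [z = d]. *)
Let w u v := if A u v then z else q.
Let D := #|V|%:R * q + 2 * z.

Lemma walk_weight_ge0 x p : 0 <= walk_weight w x p.
Proof. by apply: prodr_ge0 => e _; rewrite /w; case: ifP. Qed.

Lemma sum_adj_le (c : R) x : 0 <= c -> \sum_(y | A x y) c <= 2 * c.
Proof.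
move=> c0; rewrite sumr_const -[leLHS]mulr_natl ler_wpM2r // ler_nat.
by rewrite (leq_trans _ (A_deg x)) // cardsE.
Qed.

Lemma sum_step_weight y : \sum_x w x y <= D.
Proof.
rewrite (bigID (A y)) /= addrC lerD //.
  rewrite mulr_natl -sumr_const [leLHS]big_mkcond /=; apply: ler_sum => x _.
  by rewrite /w A_sym; case: (A x y).
apply: le_trans (sum_adj_le y z0); rewrite le_eqVlt; apply/orP; left.
by apply/eqP; apply: eq_bigr => x Ayx; rewrite /w A_sym Ayx.
Qed.

(** The end is fixed and the start is free: summing over the start first costs [D] for the first
    step and leaves the same sum for the rest, with no factor [#|V|]. *)
Lemma sum_walks_all l :
  \sum_x \sum_(p : l.-tuple V | last x p == t) walk_weight w x p <= D ^+ l.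
Proof.
elim: l => [|l IHl].
  rewrite expr0 (eq_bigr (fun x => (x == t)%:R)) => [|x _].
    by rewrite (bigD1 t) //= eqxx big1 ?addr0 // => x /negPf ->.
  rewrite big_mkcond (eq_bigr (fun=> (x == t)%:R)) => [|p _].
    by rewrite sumr_const card_tuple expn0.
  by rewrite tuple0 /= /walk_weight big_nil; case: eqP.
rewrite exprS; under eq_bigr do rewrite (@sum_tuple_cons _ _ _ (fun p => last _ p == t)).
rewrite exchange_big /=; apply: le_trans (ler_wpM2l _ IHl).
  rewrite mulr_sumr; apply: ler_sum => y _.
  under eq_bigr do under eq_bigr do rewrite walk_weight_cons.
  under eq_bigr do rewrite -mulr_sumr.
  rewrite -mulr_suml ler_wpM2r ?sum_step_weight //.
  by apply: sumr_ge0 => *; apply: walk_weight_ge0.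
by rewrite addr_ge0 ?mulr_ge0.
Qed.

(* Conditioning on the first step outside [A] frees its far endpoint, which
   saves the factor [#|V|] over the bound for walks inside [A]. *)
Lemma sum_walks_leaving l x :
  #|V|%:R * (\sum_(p : l.-tuple V | (last x p == t) && ~~ path A x p)
     walk_weight w x p) <= D ^+ l.
Proof.
have D0 : 0 <= D by rewrite addr_ge0 ?mulr_ge0.
elim: l x => [|l IHl] x.
  by rewrite big1 ?mulr0 ?exprn_ge0 // => p; rewrite tuple0 andbF.
rewrite (@sum_tuple_cons _ _ _ (fun p => (last x p == t) && ~~ path A x p)) exprS.
pose T y := \sum_(p : l.-tuple V | last y p == t) walk_weight w y p.
pose B y := \sum_(p : l.-tuple V | (last y p == t) && ~~ path A y p) walk_weight w y p.
have T0 y : 0 <= T y by apply: sumr_ge0 => *; apply: walk_weight_ge0.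
rewrite (eq_bigr (fun y => if A x y then z * B y else q * T y)) => [|y _]; last first.
  rewrite /= /B /T; under eq_bigr do rewrite walk_weight_cons {1}/w.
  by case: ifP => Axy; rewrite mulr_sumr //; apply: eq_bigl => p; rewrite andbT.
(* A first step outside [A] leaves an arbitrary walk, bounded by [sum_walks_all]; a first step
   inside [A] has at most two choices and leaves a walk that must still quit [A]. *)
rewrite (bigID (A x)) /= mulrDr addrC /D mulrDl; apply: lerD.
  rewrite -mulrA ler_wpM2l //; apply: le_trans (ler_wpM2l q0 (sum_walks_all l)).
  rewrite [leRHS]mulr_sumr [leLHS]big_mkcond /=; apply: ler_sum => y _.
  by case: (A x y) => /=; rewrite ?lexx // mulr_ge0 // T0.
rewrite mulr_sumr -mulrA; apply: le_trans (sum_adj_le x (mulr_ge0 z0 (exprn_ge0 l D0))).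
by apply: ler_sum => y ->; rewrite mulrCA ler_wpM2l //; apply: IHl.
Qed.

End WalkSums.

(** * From walk weights to products over edges *)

Section PathWeight.
Variables (R : realFieldType) (V : finType).

Lemma prod_walk_edges (f : {set V} -> R) x p : uniq (x :: p) ->
  \prod_(e in walk_edges x p) f (val e) =
  walk_weight (fun u v => f [set u; v]) x p.
Proof.
elim: p x => [|y p IHp] x up.
  by rewrite walk_edges_nil big_set0 /walk_weight /= big_nil.
have [|e ve] := @pair_edge _ x y.
  by move: up; rewrite /= !inE; case: eqP.
rewrite walk_weight_cons (walk_edges_consU p ve) big_setU1 ?(head_edge_notin up) //=.
by rewrite ve IHp //; move: up => /= /andP[].
Qed.

Lemma walk_weight_setID (P : graph V) (q z : R) x p : uniq (x :: p) ->
  walk_weight (fun u v => if adj P u v then z else q) x p =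
  z ^+ #|walk_edges x p :&: P| * q ^+ #|walk_edges x p :\: P|.
Proof.
move=> up; pose f S := if [exists e : edge V, (e \in P) && (val e == S)] then z else q.
rewrite -[LHS]/(walk_weight (fun u v => f [set u; v]) x p) -prod_walk_edges //.
rewrite (big_setID P) /= -!prodr_const.
have fE (e : edge V) : f (val e) = if e \in P then z else q.
  rewrite /f; congr (if _ then _ else _); apply/fintype.existsP/idP => [[e' /andP[eP]]|eP].
    by rewrite val_eqE => /eqP <-.
  by exists e; rewrite eP eqxx.
by congr (_ * _); apply: eq_bigr => e; rewrite !inE fE;
  [case/andP=> _ -> | case/andP=> /negPf ->].
Qed.

End PathWeight.

(** * Correlated random graphs *)

Lemma sum_set_prod (R : comPzRingType) (T : finType) (h : T -> bool -> R) :
  \sum_(A : {set T}) \prod_e h e (e \in A) = \prod_e (h e true + h e false).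
Proof.
rewrite bigA_distr; apply: eq_bigr => A _; apply: eq_bigr => e _.
by case: (e \in A).
Qed.

Lemma prod_natb (R : comPzRingType) (T : finType) (b : pred T) :
  \prod_e (b e)%:R = [forall e, b e]%:R :> R.
Proof.
have [/fintype.forallP ball|/forallPn[e be]] := boolP [forall e, b e].
  by rewrite big1 // => e _; rewrite ball.
by rewrite (bigD1 e) //= (negPf be) mul0r.
Qed.

Section PairExpectation.
Variables (R : realType) (V : finType) (q rho : R).
Hypotheses (q01 : 0 <= q <= 1) (rho01 : 0 <= rho <= 1).
Implicit Types (f g : graph V -> graph V -> R) (P Q : graph V).

Definition pair_expectation f : R :=
  \sum_G \sum_U \sum_F bernoulli_subset q G * bernoulli_subset (1 - rho) U *
    bernoulli_subset q F * f G (resample G U F).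

Lemma bernoulli_subset_ge0 (T : finType) (p : R) (A : {set T}) :
  0 <= p <= 1 -> 0 <= bernoulli_subset p A.
Proof.
by move=> /andP[p0 p1]; apply: prodr_ge0 => e _; case: ifP; rewrite ?subr_ge0.
Qed.

Lemma le_pair_expectation f g : (forall G1 G2, f G1 G2 <= g G1 G2) ->
  pair_expectation f <= pair_expectation g.
Proof.
move=> fg; do 3![apply: ler_sum => ? _]; rewrite ler_wpM2l //.
have rho01' : 0 <= 1 - rho <= 1 by case/andP: rho01 => r0 r1; apply/andP; split; lra.
by rewrite !mulr_ge0 // bernoulli_subset_ge0.
Qed.

Lemma eq_pair_expectation f g : (forall G1 G2, f G1 G2 = g G1 G2) ->
  pair_expectation f = pair_expectation g.
Proof. by move=> fg; do 3![apply: eq_bigr => ? _]; rewrite fg. Qed.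

Lemma pair_expectation_sum (I : finType) (S : pred I) (F : I -> graph V -> graph V -> R) :
  pair_expectation (fun G1 G2 => \sum_(i | S i) F i G1 G2) =
  \sum_(i | S i) pair_expectation (F i).
Proof.
rewrite /pair_expectation [RHS]exchange_big; apply: eq_bigr => G _ /=.
rewrite [RHS]exchange_big; apply: eq_bigr => U _ /=.
by rewrite [RHS]exchange_big; apply: eq_bigr => W _ /=; rewrite mulr_sumr.
Qed.

Lemma pair_expectationB f g :
  pair_expectation (fun G1 G2 => f G1 G2 - g G1 G2) =
  pair_expectation f - pair_expectation g.
Proof.
rewrite /pair_expectation -sumrB; apply: eq_bigr => G _.
rewrite -sumrB; apply: eq_bigr => U _.
by rewrite -sumrB; apply: eq_bigr => F _; rewrite mulrBr.
Qed.

Lemma pair_expectationD f g :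
  pair_expectation (fun G1 G2 => f G1 G2 + g G1 G2) =
  pair_expectation f + pair_expectation g.
Proof.
rewrite /pair_expectation -big_split /=; apply: eq_bigr => G _.
rewrite -big_split /=; apply: eq_bigr => U _.
by under eq_bigr do rewrite mulrDr; rewrite big_split.
Qed.

Lemma pair_expectationZ (c : R) f :
  pair_expectation (fun G1 G2 => c * f G1 G2) = c * pair_expectation f.
Proof.
rewrite /pair_expectation mulr_sumr; apply: eq_bigr => G _.
rewrite mulr_sumr; apply: eq_bigr => U _.
by rewrite mulr_sumr; apply: eq_bigr => F _; rewrite mulrCA.
Qed.

(** Probability that an edge of the first graph is in the second: it is kept, or resampled and drawn
    again. *)
Let r := rho + (1 - rho) * q.

(** All three random subsets have product laws, so the sum factors over vertex pairs; [h] is the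
    contribution of one pair, with [g], [u], [f] telling whether it is in the first graph,
    resampled, freshly drawn. *)
Lemma pair_expectation_sub_prod P Q :
  pair_expectation (fun G1 G2 => ((P \subset G1) && (Q \subset G2))%:R) =
  \prod_e (if e \in P then if e \in Q then q * r else q
           else if e \in Q then q else 1).
Proof.
pose h (e : edge V) (g u f : bool) : R :=
  (if g then q else 1 - q) * (if u then 1 - rho else 1 - (1 - rho)) *
  (if f then q else 1 - q) *
  (((e \in P) ==> g) && ((e \in Q) ==> (g && ~~ u || f && u)))%:R.
transitivity (\sum_(G : graph V) \sum_(U : graph V) \sum_(F : graph V)
    \prod_e h e (e \in G) (e \in U) (e \in F)).
  apply: eq_bigr => G _; apply: eq_bigr => U _; apply: eq_bigr => F _.
  rewrite /h !big_split /= prod_natb; congr (_ * _%:R).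
  congr nat_of_bool; apply/andP/fintype.forallP => [[/subsetP PG /subsetP QG] e|sub].
    apply/andP; split; apply/implyP => /[dup] eA.
      by move/PG.
    by move/QG; rewrite !inE andbC.
  split; apply/subsetP => e eA; move/andP: (sub e); rewrite eA.
    by case.
  by case=> _; rewrite !inE andbC.
transitivity (\sum_(G : graph V) \sum_(U : graph V)
    \prod_e (h e (e \in G) (e \in U) true + h e (e \in G) (e \in U) false)).
  apply: eq_bigr => G _; apply: eq_bigr => U _.
  exact: (sum_set_prod (fun e b => h e (e \in G) (e \in U) b)).
transitivity (\sum_(G : graph V) \prod_e
    (h e (e \in G) true true + h e (e \in G) true false +
     (h e (e \in G) false true + h e (e \in G) false false))).
  apply: eq_bigr => G _.
  exact: (sum_set_prod (fun e b => h e (e \in G) b true + h e (e \in G) b false)).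
rewrite (sum_set_prod (fun e b => h e b true true + h e b true false +
  (h e b false true + h e b false false))).
apply: eq_bigr => e _; rewrite /h /r.
by case: (e \in P); case: (e \in Q) => /=; ring.
Qed.

Lemma pair_expectation_sub P Q :
  pair_expectation (fun G1 G2 => ((P \subset G1) && (Q \subset G2))%:R) =
  q ^+ #|P| * q ^+ #|Q :\: P| * r ^+ #|P :&: Q|.
Proof.
rewrite pair_expectation_sub_prod -!prodr_const.
rewrite (big_mkcond (fun e => e \in P)) (big_mkcond (fun e => e \in Q :\: P)).
rewrite (big_mkcond (fun e => e \in P :&: Q)) -!big_split /=.
by apply: eq_bigr => e _; rewrite !inE; case: (e \in P); case: (e \in Q) => /=; ring.
Qed.

(** Dropping the powers of [r <= 1] gives the probability that [P] and [Q] both lie in the first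
    graph, so one bound serves both graphs. *)
Lemma pair_expectation_sub_le P Q :
  pair_expectation (fun G1 G2 => ((P \subset G1) && (Q \subset G2))%:R)
    <= q ^+ #|P| * q ^+ #|Q :\: P|.
Proof.
rewrite pair_expectation_sub ler_piMr ?mulr_ge0 ?exprn_ge0 ?exprn_ile1 //.
- by case/andP: q01.
- by case/andP: q01.
- by rewrite /r; case/andP: q01 => ? ?; case/andP: rho01 => ? ?; nra.
- by rewrite /r; case/andP: q01 => ? ?; case/andP: rho01 => ? ?; nra.
Qed.

Lemma pair_expectation_sub1 P :
  pair_expectation (fun G1 G2 => (P \subset G1)%:R) = q ^+ #|P|.
Proof.
transitivity (pair_expectation (fun G1 G2 => ((P \subset G1) && (set0 \subset G2))%:R)).
  by apply: eq_pair_expectation => G1 G2; rewrite sub0set andbT.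
by rewrite pair_expectation_sub set0D setI0 cards0 !mulr1.
Qed.

End PairExpectation.

(** * Couplings, sampled paths and counts of walks *)

Section Coupling.
Variables (R : realType) (T : finType).

Lemma sum_uniform (A : {set T}) : A != set0 -> \sum_x uniform R A x = 1.
Proof.
move=> A0; rewrite /uniform -big_mkcond /= sumr_const -[LHS]mulr_natl divff //.
by rewrite pnatr_eq0 cards_eq0.
Qed.

(** A zero marginal kills a whole row or column, so the coupling lives on pairs from [A] and [B],
    where [f] is at least [c], and its total mass is 1. *)
Lemma coupling_uniform_ge (A B : {set T}) (pi f : T -> T -> R) (c : R) :
  A != set0 -> is_coupling (uniform R A) (uniform R B) pi ->
  (forall x y, x \in A -> y \in B -> c <= f x y) ->
  c <= \sum_x \sum_y pi x y * f x y.
Proof.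
move=> A0 [pi0 piA piB] cf.
rewrite -[c]mul1r -(sum_uniform A0) mulr_suml; apply: ler_sum => x _.
rewrite -piA mulr_suml; apply: ler_sum => y _.
have [xA|xA] := boolP (x \in A); last first.
  have := piA x; rewrite /uniform (negPf xA) => /psumr_eq0P ->; rewrite ?mul0r //.
have [yB|yB] := boolP (y \in B); last first.
  have := piB y; rewrite /uniform (negPf yB) => /psumr_eq0P ->; rewrite ?mul0r //.
by rewrite ler_wpM2l // cf.
Qed.

End Coupling.

Section Overlap.
Variables (R : realType) (T : finType).
Implicit Types P Q : {set T}.

Lemma overlap_refl P : P != set0 -> overlap R P P = 1.
Proof.
move=> P0; rewrite /overlap setIid -expr2 sqrtr_sqr ger0_norm // divff //.
by rewrite pnatr_eq0 cards_eq0.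
Qed.

(** The overlap is at most the square root of [#|P| / #|Q|], so [#|Q|] is below 100/81 of [#|P|],
    and the intersection exceeds 9/10 of [#|P|]; 5/4 and 3/4 are weakenings. *)
Lemma overlap_gt_card P Q : (#|P| <= #|Q|)%N -> (9 / 10 < overlap R P Q) ->
  (4 * #|Q| <= 5 * #|P|)%N /\ (3 * #|P| <= 4 * #|Q :&: P|)%N.
Proof.
move=> PQ; rewrite /overlap setIC.
have JP : (#|Q :&: P| <= #|P|)%N by rewrite subset_leq_card ?subsetIr.
have [P0|P0] := posnP #|P|.
  by rewrite P0 mul0r sqrtr0 invr0 mulr0 ltNge divr_ge0.
have ab0 : 0 < #|P|%:R * #|Q|%:R :> R.
  by rewrite mulr_gt0 ?ltr0n // (leq_trans P0).
rewrite ltr_pdivlMr ?sqrtr_gt0 // => h.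
have : (81 * (#|P| * #|Q|) < 100 * (#|Q :&: P| * #|Q :&: P|))%N.
  rewrite -(ltr_nat R) !natrM -(@sqr_sqrtr _ (#|P|%:R * #|Q|%:R)) ?ltW //.
  have := sqrtr_ge0 (#|P|%:R * #|Q|%:R : R); nra.
by nia.
Qed.

End Overlap.

(** * Simple walks between two fixed vertices *)

Section SimpleWalks.
Variables (R : realType) (V : finType) (s t : V).
Implicit Types (p c : seq V) (G : graph V).

Definition simple_walk p := uniq (s :: p) && (last s p == t).

Lemma st_pathP G P : is_st_path G s t P <->
  exists2 c, simple_walk c & P = walk_edges s c /\ walk_edges s c \subset G.
Proof.
split=> [[c [pc lc uc ->]]|[c /andP[uc /eqP lc] [-> cG]]].
  by exists c; [rewrite /simple_walk uc lc eqxx | split => //; apply: path_walk_edges].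
by exists c; split => //; apply: walk_edges_path.
Qed.

Lemma sampled_paths_neq0 G : sampled_paths G s t != set0.
Proof.
rewrite /sampled_paths; case: ifP => [_|->] //.
by apply/set0Pn; exists set0; rewrite inE.
Qed.

Lemma sampled_pathsP G P : P \in sampled_paths G s t -> P = set0 \/
  exists2 c, simple_walk c & P = walk_edges s c /\ walk_edges s c \subset G.
Proof.
rewrite /sampled_paths; case: ifP => _; rewrite inE; first by move/eqP; left.
by move/asboolP => [/st_pathP]; right.
Qed.

Lemma sampled_paths_unique G p : simple_walk p -> walk_edges s p \subset G ->
  (forall c, simple_walk c -> c != p -> (size c <= size p)%N ->
     ~~ (walk_edges s c \subset G)) ->
  sampled_paths G s t = [set walk_edges s p].
Proof.
move=> sp pG rival.
suff shE : shortest_paths G s t = [set walk_edges s p].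
  rewrite /sampled_paths shE ifF //; apply/eqP => /setP/(_ (walk_edges s p)).
  by rewrite !inE eqxx.
have up : uniq (s :: p) by case/andP: sp.
have pst : is_st_path G s t (walk_edges s p) by apply/st_pathP; exists p.
apply/setP => P; rewrite !inE; apply/asboolP/eqP => [[/st_pathP[c sc [-> cG]] min]|->].
  have /andP[uc _] := sc; have := min _ pst; rewrite !card_walk_edges // => cp.
  by have [->//|cNp] := eqVneq c p; move: (rival c sc cNp cp); rewrite cG.
split=> // Q /st_pathP[c sc [-> cG]].
have /andP[uc _] := sc; rewrite !card_walk_edges // leqNgt; apply/negP => cp.
have cNp : c != p by apply: contraTneq cp => ->; rewrite ltnn.
by move: (rival c sc cNp (ltnW cp)); rewrite cG.
Qed.

Lemma bernoulli_ineq (x : R) m : 0 <= x <= 1 -> 1 - m%:R * x <= (1 - x) ^+ m.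
Proof.
case/andP=> x0 x1; elim: m => [|m IHm]; first by rewrite mul0r subr0 expr0.
rewrite exprS; apply: (@le_trans _ _ ((1 - x) * (1 - m%:R * x))).
  have : 0 <= m%:R * (x * x) by rewrite !mulr_ge0.
  by rewrite -natr1; nra.
by rewrite ler_wpM2l // subr_ge0.
Qed.

(** The [k] inner vertices form an injective sequence avoiding [s] and [t]. There are at least
    [(n - k - 1)^k] of these, and Bernoulli's inequality bounds this below by
    [n^k (1 - k (k + 1) / n)]. *)
Lemma card_simple_walks k : s != t -> 2 * k.+1%:R ^+ 2 <= #|V|%:R :> R ->
  #|V|%:R ^+ k / 2 <= #|[set p : k.+1.-tuple V | simple_walk p]|%:R :> R.
Proof.
move=> st kn; set n := #|V|.
pose inner := [set c : k.-tuple V | all (fun v => v \in ~: [set s; t]) c & uniq c].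
pose ext (c : k.-tuple V) : k.+1.-tuple V := [tuple of rcons c t].
have ext_inj : injective ext.
  by move=> c c' /(congr1 val) /rcons_inj /(congr1 fst) /val_inj.
have sub : [set ext c | c in inner] \subset [set p : k.+1.-tuple V | simple_walk p].
  apply/subsetP => _ /imsetP[c + ->]; rewrite !inE => /andP[/allP cst uc].
  rewrite /simple_walk /= last_rcons eqxx andbT rcons_uniq uc andbT.
  rewrite mem_rcons inE (negPf st) /=; apply/andP; split; apply/negP => /cst;
    by rewrite !inE eqxx ?orbT.
have card_le := subset_leq_card sub; rewrite card_imset // card_uniq_tuples in card_le.
have c2 : #|[pred v | v \in ~: [set s; t]]| = (n - 2)%N.
  have := cardsC [set s; t]; rewrite cards2 st /= /n => <-.
  by rewrite addKn; apply: eq_card => v; rewrite !inE.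
have kn' : (k.+1 <= n)%N.
  rewrite -(ler_nat R); apply: le_trans kn.
  have : 1 <= k.+1%:R :> R by rewrite ler1n.
  nra.
have fle : ((n - k.+1) ^ k <= (n - 2) ^_ k)%N.
  rewrite ffact_prod -[X in (_ ^ X <= _)%N](card_ord k) -prod_nat_const.
  by apply: leq_prod => i _; have := ltn_ord i; lia.
apply: (@le_trans _ _ ((n - k.+1) ^ k)%N%:R); last first.
  by rewrite ler_nat (leq_trans fle) // -c2.
have n0 : 0 < n%:R :> R by rewrite ltr0n; lia.
rewrite natrX natrB //.
have -> : n%:R - k.+1%:R = n%:R * (1 - k.+1%:R / n%:R) :> R by field; rewrite gt_eqF.
rewrite exprMn ler_wpM2l ?exprn_ge0 ?(ltW n0) //.
apply: le_trans (bernoulli_ineq _ _); last first.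
  by rewrite divr_ge0 ?(ltW n0) //= ler_pdivrMr // mul1r ler_nat.
suff : k%:R * (k.+1%:R / n%:R) <= 2^-1 :> R by lra.
rewrite mulrA ler_pdivrMr //.
have : k%:R <= k.+1%:R :> R by rewrite ler_nat.
have : 0 <= k%:R :> R by [].
rewrite -/n in kn; nra.
Qed.

Section Rivals.
Variables (p : seq V) (q z : R).
Hypotheses (sp : simple_walk p) (q0 : 0 <= q) (z1 : 1 <= z).

(** By [walk_edges_sub_eq] a simple walk other than [p] must leave the edges of [p], so
    [sum_walks_leaving] applies. Its weight is at least [z ^+ j] times the summand, whence the
    division. *)
Lemma sum_rivals (B : pred (seq V)) j l :
  (forall c, size c = l -> B c -> [/\ simple_walk c, c != p &
     (j <= #|walk_edges s c :&: walk_edges s p|)%N]) ->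
  \sum_(c : l.-tuple V | B c) q ^+ #|walk_edges s c :\: walk_edges s p| <=
  (#|V|%:R * q + 2 * z) ^+ l / z ^+ j / #|V|%:R.
Proof.
move=> HB; set P := walk_edges s p.
have up : uniq (s :: p) by case/andP: sp.
have zgt0 : 0 < z by apply: lt_le_trans z1.
have n0 : 0 < #|V|%:R :> R by rewrite ltr0n; apply/card_gt0P; exists s.
pose w u v := if adj P u v then z else q.
have w0 c : 0 <= walk_weight w s c by apply: walk_weight_ge0 => //; apply: ltW.
rewrite ler_pdivlMr // ler_pdivlMr ?exprn_gt0 //.
apply: le_trans (@sum_walks_leaving _ _ (adj P) q z t q0 (ltW zgt0) (@adjC _ _) _ l s).
  rewrite -mulrA mulrC -mulrA ler_wpM2l ?(ltW n0) // mulr_sumr.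
  rewrite big_mkcond [leRHS]big_mkcond /=; apply: ler_sum => c _.
  have [Bc|_] := boolP (B c); last by case: ifP.
  have [/andP[uc /eqP lc] cNp jc] := HB c (size_tuple c) Bc.
  rewrite lc eqxx /= ifT; last first.
    apply: contra cNp => pc; apply/eqP; apply: walk_edges_sub_eq pc => //.
    by rewrite lc; case/andP: sp => _ /eqP.
  rewrite [leRHS]walk_weight_setID // ler_wpM2r ?exprn_ge0 //.
  by rewrite ler_weXn2l.
by move=> x; apply: leq_trans (walk_edges_degree x up); rewrite leq_addr.
Qed.

End Rivals.

Definition count_walks N (B : pred (seq V)) G : R :=
  \sum_(l < N) \sum_(c : l.-tuple V | B c) (walk_edges s c \subset G)%:R.

Lemma count_walks_ge0 N B G : 0 <= count_walks N B G.
Proof. by apply: sumr_ge0 => l _; apply: sumr_ge0. Qed.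

Lemma count_walks_ge1 N (B : pred (seq V)) G c : (size c < N)%N -> B c ->
  walk_edges s c \subset G -> 1 <= count_walks N B G.
Proof.
move=> cN Bc cG; rewrite /count_walks (bigD1 (Ordinal cN)) //=.
rewrite (bigD1 (in_tuple c)) //= cG -addrA lerDl addr_ge0 //; first exact: sumr_ge0.
by apply: sumr_ge0 => l _; apply: sumr_ge0.
Qed.

End SimpleWalks.

(** Two indices satisfying [X] force [Y >= 1] on each other, so at most one term is positive, and it
    is at most 1. Taking expectations turns a first moment bound on the sum into a lower bound for
    that of [Phi]. *)
Lemma sum_isolated_le (R : realFieldType) (I : finType) (S : pred I)
    (X : I -> bool) (Y : I -> R) (Phi c : R) :
  0 <= c -> 0 <= Phi -> (forall i, 0 <= Y i) ->
  (forall i j, S i -> S j -> i != j -> X i -> X j -> 1 <= Y j) ->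
  (forall i, S i -> X i -> Y i < 1 -> c <= Phi) ->
  c * (\sum_(i | S i) (X i)%:R * (1 - Y i)) <= Phi.
Proof.
move=> c0 Phi0 Y0 iso cPhi.
have [i /and3P[Si Xi Yi]|none] := pickP [pred i | [&& S i, X i & Y i < 1]].
  apply: le_trans (cPhi i Si Xi Yi); rewrite ler_piMr //.
  rewrite (bigD1 i) //= Xi mul1r -[leRHS]addr0 lerD //; first by rewrite gerBl.
  apply: sumr_le0 => j /andP[Sj ji]; have [Xj|] := boolP (X j); last by rewrite mul0r.
  by rewrite mul1r subr_le0 (iso i) // eq_sym.
apply: le_trans Phi0; rewrite mulr_ge0_le0 //.
apply: sumr_le0 => j Sj; have [Xj|] := boolP (X j); last by rewrite mul0r.
by have := none j; rewrite /= Sj Xj /= mul1r subr_le0 leNgt => ->.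
Qed.

(** * The variance bound for tuned parameters *)

Lemma sum_geometric_le (R : realFieldType) (x : R) m : 2 <= x ->
  \sum_(l < m.+1) x ^+ l <= 2 * x ^+ m.
Proof.
move=> x2; elim: m => [|m IHm]; first by rewrite big_ord1 expr0; lra.
rewrite big_ord_recr /= [x ^+ m.+1]exprS.
have xm : 0 <= x ^+ m by rewrite exprn_ge0 //; lra.
by nra.
Qed.

(** By induction [(1 + x)^m (1 - m x) <= 1], and the second factor is at least 1/2. *)
Lemma expr1D_le2 (R : realFieldType) (x : R) m : 0 <= x -> m%:R * x <= 2^-1 ->
  (1 + x) ^+ m <= 2.
Proof.
move=> x0 mx.
suff : (1 + x) ^+ m * (1 - m%:R * x) <= 1.
  have : 0 <= (1 + x) ^+ m by rewrite exprn_ge0 //; lra.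
  by nra.
elim: m {mx} => [|m IHm]; first by rewrite expr0 mul0r subr0 mulr1.
apply: le_trans IHm; rewrite exprS mulrAC [X in X <= _]mulrC ler_wpM2l //.
  by rewrite exprn_ge0 //; lra.
have : 0 <= m%:R * (x * x) by rewrite !mulr_ge0.
by rewrite -natr1; nra.
Qed.

Section VarianceBound.
Variables (R : realType) (V : finType) (s t : V) (k : nat) (q rho : R).
Variable kappa : path_coupling R V.
Let n : R := #|V|%:R.
Let d := n * q.
Let r := rho + (1 - rho) * q.
Hypothesis st : s != t.
Hypothesis k3 : (3 <= k)%N.
Hypothesis d_large : 324 <= d.
Hypothesis k_small : 4 * k%:R <= d.
Hypothesis d_pow : d ^+ k = n / 64.
Hypothesis rho01 : 0 <= rho <= 1.
Hypothesis r_pow : r ^+ k = 2^-1.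
Hypothesis kappaP : forall G1 G2 : graph V,
  is_coupling (uniform R (sampled_paths G1 s t))
              (uniform R (sampled_paths G2 s t)) (kappa G1 G2).

Local Notation W p := (walk_edges s p).
Local Notation simple := (simple_walk s t).

Let n0 : 0 < n.
Proof. by rewrite ltr0n; apply/card_gt0P; exists s. Qed.

Let d3_le : d ^+ 3 <= n / 64.
Proof. by rewrite -d_pow ler_weXn2l //; have := d_large; lra. Qed.

Let q01 : 0 <= q <= 1.
Proof.
have := d3_le; have := d_large; have := n0; rewrite /d => ? ? ?.
have d3 : n * q <= (n * q) ^+ 3 by rewrite -[leLHS]expr1 ler_weXn2l //; lra.
by apply/andP; split; nra.
Qed.

Let q0 : 0 <= q. Proof. by case/andP: q01. Qed.

Definition rivals (p : seq V) : pred (seq V) :=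
  [pred c | simple c && (c != p)].

(** By [overlap_gt_card], only these among the paths longer than [k] can have overlap above 9/10
    with a path [p] of length [k]. *)
Definition near_copies (p : seq V) : pred (seq V) :=
  [pred c | [&& simple c, (k < size c)%N, (4 * size c <= 5 * k)%N &
    (3 * k <= 4 * #|W c :&: W p|)%N]].

(** With [z = 1] the geometric sum is at most [2 (d + 2)^k / n]; as [4 k <= d], this is at most
    [4 d^k / n = 1/16]. *)
Lemma rivals_weight p : simple p -> \sum_(l < k.+1) \sum_(c : l.-tuple V | rivals p c)
    q ^+ #|W c :\: W p| <= 16^-1.
Proof.
move=> sp; apply: (@le_trans _ _ (\sum_(l < k.+1) (d + 2) ^+ l / n)).
  apply: ler_sum => l _.
  have := @sum_rivals R V s t p q 1 sp q0 (lexx 1) (rivals p) 0 l.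
  rewrite expr0 divr1 mulr1; apply => c _ /andP[sc cp]; split => //.
rewrite -mulr_suml ler_pdivrMr //.
apply: (@le_trans _ _ (2 * (d + 2) ^+ k)).
  by apply: sum_geometric_le; have := d_large; lra.
have d0 : 0 < d by have := d_large; lra.
have -> : d + 2 = d * (1 + 2 / d) by field; rewrite gt_eqF.
rewrite exprMn d_pow.
have : (1 + 2 / d) ^+ k <= 2.
  apply: expr1D_le2; first by rewrite divr_ge0 // ltW.
  by rewrite mulrA ler_pdivrMr //; have := k_small; lra.
by have := n0; nra.
Qed.

(** With [z = d], length [l <= 5k/4] costs [(3 d)^l] and at least [j], the ceiling of [3k/4], shared
    edges repay [d^j], leaving at most [(9 g)^k] for [g] the square root of [d]. There are at most
    [2^k] lengths, and [18 g <= d] because [d >= 324]. *)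
Lemma near_copies_weight p : simple p -> size p = k ->
  \sum_(l < k.*2) \sum_(c : l.-tuple V | near_copies p c)
    q ^+ #|W c :\: W p| <= 64^-1.
Proof.
move=> sp pk.
have d0 : 0 < d by have := d_large; lra.
pose g := Num.sqrt d.
have g18 : 18 <= g.
  by rewrite -(@ger0_norm _ 18) // -sqrtr_sqr ler_wsqrtr //; have := d_large; lra.
have g2 : g ^+ 2 = d by rewrite sqr_sqrtr // ltW.
have g0 : 0 < g by lra.
apply: (@le_trans _ _ (\sum_(l < k.*2) (9 * g) ^+ k / n)).
  apply: ler_sum => l _.
  have [l54|l54] := leqP (4 * l) (5 * k); last first.
    rewrite big1 => [|c]; first by rewrite divr_ge0 ?exprn_ge0 ?mulr_ge0 // ltW.
    by rewrite /near_copies /= size_tuple [(4 * _ <= _)%N]leqNgt l54 !andbF.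
  pose j := ((3 * k + 3) %/ 4)%N.
  have dz : 1 <= d by have := d_large; lra.
  have := @sum_rivals R V s t p q d sp q0 dz (near_copies p) j l.
  move=> /(_ _)/le_trans; apply.
    move=> c cl /and4P[sc kc _ jc]; split => //.
      by apply: contraTneq kc => ->; rewrite pk ltnn.
    by move: jc; rewrite /j; clear; lia.
  rewrite ler_pM2r ?invr_gt0 // ler_pdivrMr ?exprn_gt0 //.
  rewrite -/n -/d (_ : d + 2 * d = 3 * d); last by ring.
  rewrite (exprMn _ 3 d) (exprMn _ 9 g) -g2 -!exprM -mulrA -exprD; apply: ler_pM.
  - by rewrite exprn_ge0.
  - by rewrite exprn_ge0 // ltW.
  - rewrite (_ : 9 = 3 ^+ 2 :> R); last by ring.
    by rewrite -exprM ler_weXn2l ?ler1n //; move: l54; clear; lia.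
  - by rewrite ler_weXn2l //; [lra | move: l54; rewrite /j; clear; lia].
rewrite sumr_const card_ord -[leLHS]mulr_natl.
apply: (@le_trans _ _ (2 ^+ k * ((9 * g) ^+ k / n))).
  rewrite ler_wpM2r ?divr_ge0 ?exprn_ge0 ?mulr_ge0 ?(ltW n0) ?(ltW g0) //.
  rewrite -natrX ler_nat -(prednK (ltnW (ltnW k3))) expnS -mul2n leq_mul2l /=.
  by rewrite ltn_expl.
rewrite mulrA -exprMn ler_pdivrMr //.
apply: (@le_trans _ _ (d ^+ k)); last by rewrite d_pow; lra.
by rewrite lerXn2r ?nnegrE ?mulr_ge0 ?(ltW g0) ?(ltW d0) // -g2; nra.
Qed.

Local Notation E := (pair_expectation (V := V) q rho).

(** Here [h] selects the graph in which walks are counted. *)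
Lemma expect_count_walks (h : graph V -> graph V -> graph V) p N B :
  (forall P Q : graph V, E (fun G1 G2 => ((P \subset G1) && (Q \subset h G1 G2))%:R)
     <= q ^+ #|P| * q ^+ #|Q :\: P|) ->
  E (fun G1 G2 => (W p \subset G1)%:R * count_walks R s N B (h G1 G2)) <=
  q ^+ #|W p| * \sum_(l < N) \sum_(c : l.-tuple V | B c) q ^+ #|W c :\: W p|.
Proof.
move=> hE.
rewrite (@eq_pair_expectation _ _ q rho _ (fun G1 G2 =>
    \sum_(l < N) \sum_(c : l.-tuple V | B c)
    ((W p \subset G1) && (W c \subset h G1 G2))%:R)); last first.
  move=> G1 G2; rewrite /count_walks mulr_sumr; apply: eq_bigr => l _.
  by rewrite mulr_sumr; apply: eq_bigr => c _; rewrite -natrM mulnb.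
rewrite pair_expectation_sum mulr_sumr; apply: ler_sum => l _.
rewrite pair_expectation_sum mulr_sumr; apply: ler_sum => c _.
exact: hE.
Qed.

Lemma expect_count_walks1 p N B :
  E (fun G1 _ => (W p \subset G1)%:R * count_walks R s N B G1) <=
  q ^+ #|W p| * \sum_(l < N) \sum_(c : l.-tuple V | B c) q ^+ #|W c :\: W p|.
Proof.
apply: (expect_count_walks (h := fun G1 _ => G1)) => P Q.
rewrite (@eq_pair_expectation _ _ q rho _ (fun G1 _ => (P :|: Q \subset G1)%:R)); last first.
  by move=> G1 G2; rewrite subUset.
rewrite pair_expectation_sub1 -exprD.
by rewrite -(cardsID P (P :|: Q)) setUK setDUl setDv set0U.
Qed.

Lemma expect_count_walks2 p N B :
  E (fun G1 G2 => (W p \subset G1)%:R * count_walks R s N B G2) <=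
  q ^+ #|W p| * \sum_(l < N) \sum_(c : l.-tuple V | B c) q ^+ #|W c :\: W p|.
Proof.
apply: (expect_count_walks (h := fun _ G2 => G2)) => P Q.
exact: pair_expectation_sub_le.
Qed.

(** A single counted walk brings this to at least 1, so a value below 1 excludes all of them. *)
Definition rival_count p (G1 G2 : graph V) : R :=
  count_walks R s k.+1 (rivals p) G1 + count_walks R s k.+1 (rivals p) G2 +
  count_walks R s k.*2 (near_copies p) G2.

Lemma rival_count_ge0 p G1 G2 : 0 <= rival_count p G1 G2.
Proof. by rewrite !addr_ge0 // count_walks_ge0. Qed.

(** The constant is [1/16 + 1/16 + 1/64]. *)
Lemma expect_rival_count p : simple p -> size p = k ->
  E (fun G1 G2 => (W p \subset G1)%:R * rival_count p G1 G2) <= q ^+ k * (9 / 64).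
Proof.
move=> sp pk; have up : uniq (s :: p) by case/andP: sp.
rewrite (@eq_pair_expectation _ _ q rho _ (fun G1 G2 =>
  (W p \subset G1)%:R * count_walks R s k.+1 (rivals p) G1 +
  (W p \subset G1)%:R * count_walks R s k.+1 (rivals p) G2 +
  (W p \subset G1)%:R * count_walks R s k.*2 (near_copies p) G2)); last first.
  by move=> G1 G2; rewrite /rival_count !mulrDr.
rewrite !pair_expectationD.
have := expect_count_walks1 p k.+1 (rivals p).
have := expect_count_walks2 p k.+1 (rivals p).
have := expect_count_walks2 p k.*2 (near_copies p).
rewrite card_walk_edges // pk.
have := rivals_weight sp; have := near_copies_weight sp pk.
have : 0 <= q ^+ k by rewrite exprn_ge0.
by nra.
Qed.

(** Each [p] contributes at least [q^k (1/2 - 9/64) >= q^k / 4]. There are at least [n^(k-1) / 2]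
    choices of [p], and [n^(k-1) q^k = 1/64]. *)
Lemma expect_isolated (X : seq V -> graph V -> graph V -> bool) :
  (forall p G1 G2, X p G1 G2 -> W p \subset G1) ->
  (forall p, simple p -> size p = k ->
     E (fun G1 G2 => (X p G1 G2)%:R) = q ^+ k / 2) ->
  512^-1 <= E (fun G1 G2 => \sum_(p : k.-tuple V | simple p)
    (X p G1 G2)%:R * (1 - rival_count p G1 G2)).
Proof.
move=> XW EX; rewrite pair_expectation_sum.
apply: (@le_trans _ _ (\sum_(p : k.-tuple V | simple p) q ^+ k / 4)); last first.
  apply: ler_sum => p sp.
  rewrite (@eq_pair_expectation _ _ q rho _ (fun G1 G2 => (X p G1 G2)%:R -
    (X p G1 G2)%:R * rival_count p G1 G2)); last first.
    by move=> G1 G2; rewrite mulrBr mulr1.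
  rewrite pair_expectationB EX ?size_tuple //.
  have := expect_rival_count sp (size_tuple p).
  have : E (fun G1 G2 => (X p G1 G2)%:R * rival_count p G1 G2) <=
         E (fun G1 G2 => (W p \subset G1)%:R * rival_count p G1 G2).
    apply: le_pair_expectation => // G1 G2.
    rewrite ler_wpM2r ?rival_count_ge0 // ler_nat.
    by case: (X p G1 G2) (@XW p G1 G2) => // ->.
  have : 0 <= q ^+ k by rewrite exprn_ge0.
  by lra.
rewrite sumr_const -[leRHS]mulr_natl.
case: k k3 d_pow k_small d3_le => // k' _ dk kd d3.
have kn : 2 * k'.+1%:R ^+ 2 <= #|V|%:R :> R.
  rewrite -/n; have : 0 <= k'.+1%:R :> R by [].
  have := d_large; move: d3; rewrite !exprS expr0 !mulr1; nra.
have := card_simple_walks (R := R) st kn; rewrite cardsE -/n => card.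
have qk : 0 <= q ^+ k'.+1 by rewrite exprn_ge0.
apply: (@le_trans _ _ (n ^+ k' / 2 * (q ^+ k'.+1 / 4))); last first.
  by rewrite ler_wpM2r // divr_ge0.
have : n * (n ^+ k' * q ^+ k'.+1) = n / 64.
  by rewrite mulrA -exprS -exprMn.
by have := n0; nra.
Qed.

Definition conditional_sq (m : R) (G1 G2 : graph V) : R :=
  \sum_P1 \sum_P2 kappa G1 G2 P1 P2 * (overlap R P1 P2 - m) ^+ 2.

Lemma conditional_sq_ge0 m G1 G2 : 0 <= conditional_sq m G1 G2.
Proof.
have [k0 _ _] := kappaP G1 G2.
by do 2![apply: sumr_ge0 => ? _]; rewrite mulr_ge0 ?sqr_ge0.
Qed.

Lemma variance_pair_expectation (law := outcome_law q rho kappa)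
    (X := outcome_overlap R (V := V)) :
  variance law X = E (conditional_sq (expectation law X)).
Proof.
rewrite /variance; set m := expectation law X; rewrite /expectation.
transitivity (\sum_G \sum_U \sum_F \sum_P1 \sum_P2
    law (G, U, F, P1, P2) * (X (G, U, F, P1, P2) - m) ^+ 2).
  by rewrite !pair_bigA /=; apply: eq_bigr => -[[[[G U] F] P1] P2] _.
apply: eq_bigr => G _; apply: eq_bigr => U _; apply: eq_bigr => F _.
rewrite /conditional_sq mulr_sumr; apply: eq_bigr => P1 _.
by rewrite mulr_sumr; apply: eq_bigr => P2 _; rewrite /law /X /= !mulrA.
Qed.

(** * Sampling when a present path has no rival *)

Section Isolated.
Variables (p : seq V) (G1 G2 : graph V).
Hypotheses (sp : simple p) (pk : size p = k).
Hypothesis no_rival : rival_count p G1 G2 < 1.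

Lemma no_rival1 c : simple c -> c != p -> (size c <= k)%N -> ~~ (W c \subset G1).
Proof.
move=> sc cp ck; apply: contraTN no_rival => cG; rewrite -leNgt.
apply: (le_trans (@count_walks_ge1 R _ s k.+1 (rivals p) G1 c ck _ cG)).
  by rewrite /rivals /= sc.
by rewrite /rival_count -addrA lerDl addr_ge0 // count_walks_ge0.
Qed.

Lemma no_rival2 c : simple c -> c != p -> (size c <= k)%N -> ~~ (W c \subset G2).
Proof.
move=> sc cp ck; apply: contraTN no_rival => cG; rewrite -leNgt.
apply: (le_trans (@count_walks_ge1 R _ s k.+1 (rivals p) G2 c ck _ cG)).
  by rewrite /rivals /= sc.
by rewrite /rival_count addrAC lerDr addr_ge0 // count_walks_ge0.
Qed.

Lemma no_near_copy c : near_copies p c -> ~~ (W c \subset G2).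
Proof.
move=> pc; apply: contraTN no_rival => cG; rewrite -leNgt.
apply: (le_trans (@count_walks_ge1 R _ s k.*2 (near_copies p) G2 c _ pc cG)).
  by have /and4P[_ _ + _] := pc; move: k3; clear; lia.
by rewrite /rival_count lerDr addr_ge0 // count_walks_ge0.
Qed.

Hypothesis pG1 : W p \subset G1.

Let up : uniq (s :: p). Proof. by case/andP: sp. Qed.

Lemma sampled1 : sampled_paths G1 s t = [set W p].
Proof.
apply: sampled_paths_unique => // c sc cp; rewrite pk; exact: no_rival1.
Qed.

(** The overlap is 1 here and at most 9/10 in the broken case; 19/20 is the midpoint, and
    [1/400 = (1/20)^2]. *)
Lemma conditional_sq_common m : W p \subset G2 -> m <= 19 / 20 ->
  400^-1 <= conditional_sq m G1 G2.
Proof.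
move=> pG2 m1; apply: coupling_uniform_ge (kappaP G1 G2) _.
  exact: sampled_paths_neq0.
have -> : sampled_paths G2 s t = [set W p].
  by apply: sampled_paths_unique => // c sc cp; rewrite pk; exact: no_rival2.
rewrite sampled1 => x y; rewrite !inE => /eqP -> /eqP ->.
rewrite overlap_refl; first by nra.
by rewrite -card_gt0 card_walk_edges // pk; apply: leq_trans k3.
Qed.

Lemma conditional_sq_broken m : ~~ (W p \subset G2) -> 19 / 20 <= m ->
  400^-1 <= conditional_sq m G1 G2.
Proof.
move=> pG2 m1; apply: coupling_uniform_ge (kappaP G1 G2) _.
  exact: sampled_paths_neq0.
rewrite sampled1 => x y; rewrite !inE => /eqP -> yG2.
suff : overlap R (W p) y <= 9 / 10 by nra.
(* The empty set stands for a disconnected second graph and has overlap 0. *)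
have [->|[c sc [-> cG2]]] := sampled_pathsP yG2.
  by rewrite /overlap setI0 cards0 mul0r divr_ge0.
have uc : uniq (s :: c) by case/andP: sc.
have cp : c != p by apply: contraNneq pG2 => <-.
have kc : (k < size c)%N.
  by rewrite ltnNge; apply/negP => ck; move: (no_rival2 sc cp ck); rewrite cG2.
rewrite leNgt; apply/negP => /overlap_gt_card.
rewrite !card_walk_edges // pk => /(_ (ltnW kc)) [c54 c34].
have : near_copies p c by rewrite /near_copies /= sc kc c54.
by move/no_near_copy; rewrite cG2.
Qed.

End Isolated.

Lemma expect_conditional_sq_ge (X : seq V -> graph V -> graph V -> bool) m :
  (forall p G1 G2, X p G1 G2 -> W p \subset G1) ->
  (forall p, simple p -> size p = k ->
     E (fun G1 G2 => (X p G1 G2)%:R) = q ^+ k / 2) ->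
  (forall p G1 G2, simple p -> size p = k -> X p G1 G2 ->
     rival_count p G1 G2 < 1 -> 400^-1 <= conditional_sq m G1 G2) ->
  400^-1 / 512 <= E (conditional_sq m).
Proof.
move=> XW EX XC.
apply: le_trans (ler_wpM2l _ (expect_isolated XW EX)) _ => //.
rewrite -pair_expectationZ; apply: le_pair_expectation => // G1 G2.
apply: (sum_isolated_le (I := k.-tuple V)).
- by [].
- exact: conditional_sq_ge0.
- by move=> p; apply: rival_count_ge0.
(* Two distinct paths of length [k] in the first graph are rivals of each other. *)
- move=> p p' sp sp' pp' /XW pG1 _.
  rewrite leNgt; apply/negP => /no_rival1 /(_ p sp pp').
  by rewrite size_tuple pG1 => /(_ (leqnn _)).
- by move=> p sp; apply: XC => //; apply: size_tuple.
Qed.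

(** On whichever side of 19/20 the mean lies, one of the two scenarios keeps the overlap at distance
    at least 1/20 from it. *)
Lemma variance_lower_bound :
  400^-1 / 512 <=
  variance (outcome_law q rho kappa) (outcome_overlap R (V := V)).
Proof.
rewrite variance_pair_expectation; set m := expectation _ _.
have Ecommon p : simple p -> size p = k ->
    E (fun G1 G2 => ((W p \subset G1) && (W p \subset G2))%:R) = q ^+ k / 2.
  move=> /andP[up _] pk.
  by rewrite pair_expectation_sub setDv cards0 mulr1 setIid card_walk_edges // pk -/r r_pow.
have [m1|m1] := leP m (19 / 20).
  apply: (@expect_conditional_sq_ge
    (fun p G1 G2 => (W p \subset G1) && (W p \subset G2))) => //.
    by move=> p G1 G2 /andP[].
  move=> p G1 G2 sp pk /andP[pG1 pG2] norival.
  exact: conditional_sq_common pG1 _ _ _.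
apply: (@expect_conditional_sq_ge
  (fun p G1 G2 => (W p \subset G1) && ~~ (W p \subset G2))).
- by move=> p G1 G2 /andP[].
- move=> p sp pk.
  rewrite (@eq_pair_expectation _ _ q rho _ (fun G1 G2 => (W p \subset G1)%:R -
    ((W p \subset G1) && (W p \subset G2))%:R)); last first.
    by move=> G1 G2; do 2!case: (_ \subset _); rewrite ?subr0 ?subrr.
  rewrite pair_expectationB Ecommon // pair_expectation_sub1 card_walk_edges ?pk.
    by field.
  by case/andP: sp.
- move=> p G1 G2 sp pk /andP[pG1 pG2] norival.
  exact: conditional_sq_broken pG1 _ pG2 (ltW m1).
Qed.

End VarianceBound.

(** * Tuning the parameters *)

Definition tuned (R : realType) (n : nat) (a rho : R) : Prop :=
  exists k : nat, let q := edge_prob a n in let d := n%:R * q in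
  [/\ (3 <= k)%N, 324 <= d, 4 * k%:R <= d, d ^+ k = n%:R / 64 &
      (rho + (1 - rho) * q) ^+ k = 2^-1].

(* With [L = ln n] and [M = ln L], taking [k] the integer part of [L / M] makes
   [(n / 64) ^ (1 / k)] lie between [L / 64] and [e L]. *)
Lemma tuned_exists (R : realType) : exists N0 : nat, forall n, (N0 <= n)%N ->
  exists a rho : R, [/\ 64^-1 <= a <= expR 1, 0 < rho < 1 & tuned n a rho].
Proof.
(* This threshold gives [M > 256], so [k <= L / 256] and [4 k <= L / 64 <= d]. *)
exists (Num.truncn (expR (expR 256) : R)).+1 => n nN.
have n_large : expR (expR 256) < n%:R :> R.
  have /andP[_] := truncn_itv (ltW (expR_gt0 (expR 256 : R))).
  by move/lt_le_trans; apply; rewrite ler_nat.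
have n0 : 0 < n%:R :> R by apply: lt_trans n_large; apply: expR_gt0.
have [L defL] : {L : R | L = ln n%:R} by exists (ln n%:R).
have [M defM] : {M : R | M = ln L} by exists (ln L).
have [c defc] : {c : R | c = ln 64} by exists (ln 64).
have L_large : expR 256 < L by rewrite -ltr_expR defL lnK.
have L0 : 0 < L by apply: lt_trans L_large; apply: expR_gt0.
have M_large : 256 < M by rewrite -ltr_expR defM lnK.
have LM : M ^+ 2 + M <= L.
  have -> : L = expR (M / 4) ^+ 4.
    by rewrite -expRM_natl [4%:R * _]mulrC divfK // defM lnK.
  have y4 : (M / 4) ^+ 4 <= expR (M / 4) ^+ 4.
    apply: lerXn2r; rewrite ?nnegrE ?(ltW (expR_gt0 _)) //; first by lra.
    by have := expR_ge1Dx (M / 4); lra.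
  apply: le_trans y4; have : 64 < M / 4 by lra.
  have -> : M = 4 * (M / 4) by lra.
  rewrite [4 * _ / 4]mulrAC divff // mul1r; move: (M / 4) => y y64.
  have y2 : 4096 <= y ^+ 2 by rewrite expr2; nra.
  rewrite (_ : y ^+ 4 = y ^+ 2 * y ^+ 2); last by rewrite -exprD.
  by rewrite exprMn; nra.
have M0 : 0 < M by lra.
have L64 : 256 * 256 < L by rewrite expr2 in LM; nra.
have [k /andP[kle klt]] : {k : nat | k%:R <= L / M < k.+1%:R}.
  by exists (Num.truncn (L / M)); rewrite truncn_itv // divr_ge0 // ltW.
have k3 : (3 <= k)%N.
  rewrite -ltnS -(ltr_nat R); apply: le_lt_trans klt.
  by rewrite ler_pdivlMr //; rewrite expr2 in LM; nra.
have k0 : 0 < k%:R :> R by rewrite ltr0n; apply: leq_trans k3.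
have kM : k%:R * M <= L by move: kle; rewrite ler_pdivlMr.
have Mk : L < (k%:R + 1) * M by move: klt; rewrite ltr_pdivrMr // -natr1.
have [d defd] : {d : R | d = expR ((L - c) / k%:R)} by exists (expR ((L - c) / k%:R)).
have d_pow : d ^+ k = n%:R / 64.
  by rewrite defd -expRM_natl mulrC divfK ?gt_eqF // expRD expRN defL defc !lnK // posrE.
have c0 : 0 <= c by rewrite defc; apply: ln_ge0; rewrite ler1n.
have d_ge : L / 64 <= d.
  rewrite -(@lnK _ (L / 64)) ?posrE ?divr_gt0 // defd ler_expR ln_div ?posrE // -defM -defc.
  rewrite ler_pdivlMr //.
  have : c * 1 <= c * k%:R by rewrite ler_wpM2l // ler1n; apply: leq_trans k3.
  by rewrite mulrBl; lra.
(* As [k M > L - M], it suffices that [(L - M) (M + 1) >= L M], which is [LM]. *)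
have d_le : d <= expR 1 * L.
  rewrite -[X in _ * X](@lnK _ L) ?posrE // -expRD defd ler_expR -defM ler_pdivrMr //.
  suff : L <= k%:R * (M + 1) by lra.
  have : M * (k%:R * (M + 1)) >= M * L; last by rewrite ler_pM2l.
  have : (L - M) * (M + 1) <= k%:R * M * (M + 1) by rewrite ler_wpM2r //; lra.
  by rewrite expr2 in LM; lra.
have d0 : 0 < d by rewrite defd; apply: expR_gt0.
have d324 : 324 <= d by lra.
have k_small : 4 * k%:R <= d.
  apply: le_trans d_ge; rewrite ler_pdivlMr //.
  have : k%:R * 256 <= k%:R * M by rewrite ler_wpM2l // ltW.
  by lra.
have [q defq] : {q : R | q = d / n%:R} by exists (d / n%:R).
(* The [k]-th root of 1/2. Solving [rho + (1 - rho) q = r] gives the witness for [rho], in (0, 1)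
   since [q <= 1/64 < 1/2 <= r < 1]. *)
have [r defr] : {r : R | r = expR (- ln 2 / k%:R)} by exists (expR (- ln 2 / k%:R)).
have r_pow : r ^+ k = 2^-1.
  by rewrite defr -expRM_natl mulrC divfK ?gt_eqF // expRN lnK // posrE.
have ln2 : 0 < ln 2 :> R by apply: ln_gt0; rewrite ltr1n.
have r1 : r < 1 by rewrite defr expR_lt1 pmulr_llt0 ?invr_gt0 // oppr_lt0.
have r0 : 0 < r by rewrite defr; apply: expR_gt0.
have r_half : 2^-1 <= r.
  rewrite -r_pow -[leRHS]expr1 ler_wiXn2l ?(ltW r0) ?(ltW r1) //.
  by apply: leq_trans k3.
have q0 : 0 < q by rewrite defq divr_gt0.
have q64 : q <= 64^-1.
  rewrite defq ler_pdivrMr // mulrC -d_pow -[leLHS]expr1 ler_weXn2l //; first lra.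
  by apply: leq_trans k3.
have qE : edge_prob (d / L) n = q by rewrite /edge_prob -defL divfK ?gt_eqF // defq.
exists (d / L), ((r - q) / (1 - q)); split.
- by rewrite ler_pdivlMr // ler_pdivrMr // d_le andbT mulrC.
- have q1 : 0 < 1 - q by lra.
  by rewrite divr_gt0 ?ltr_pdivrMr //=; lra.
exists k; rewrite qE /= {1 2 3}defq [n%:R * _]mulrC divfK ?gt_eqF //; split => //.
rewrite -r_pow; congr (_ ^+ _); field; rewrite gt_eqF //; lra.
Qed.

(** * Bounds on lower and upper limits *)

Section LimInf.
Variable R : realType.
Local Open Scope ereal_scope.

Lemma limn_einf_ge (u : nat -> \bar R) c N0 :
  (forall n, (N0 <= n)%N -> c <= u n) -> c <= limn_einf u.
Proof.
move=> cu; rewrite limn_einf_lim.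
rewrite (cvg_lim _ (ereal_nondecreasing_cvgn (nondecreasing_einfs u))) //.
apply: (@le_trans _ _ (einfs u N0)); last by apply: ereal_sup_ubound; exists N0.
by apply: le_ereal_inf_tmp => _ [n /= Nn <-]; apply: cu.
Qed.

Lemma limn_esup_le (u : nat -> \bar R) c N0 :
  (forall n, (N0 <= n)%N -> u n <= c) -> limn_esup u <= c.
Proof.
move=> uc; rewrite -leeN2 -limn_einfN; apply: (@limn_einf_ge _ _ N0) => n Nn /=.
by rewrite leeN2 uc.
Qed.

End LimInf.

Theorem theorem4p12 (R : realType) :
  exists alpha rho : nat -> R,
    [/\ forall n, 0 < alpha n,
        (0 < limn_einf (fun n => (alpha n)%:E)
           <= limn_esup (fun n => (alpha n)%:E))%E
        /\ (limn_esup (fun n => (alpha n)%:E) < +oo)%E,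
        forall n, 0 < rho n < 1
      & forall kappa : (forall m : nat, path_coupling R 'I_m.+2),
          (forall m, is_optimal_path_coupling (vertex1 m) (vertex2 m) (kappa m)) ->
          (0 < limn_einf (fun m =>
             (overlap_variance (alpha m.+2) (rho m.+2) (kappa m))%:E))%E ].
Proof.
have [N0 tunedN] := tuned_exists R.
have /choice[ar arP] : forall n, exists ar : R * R,
    [/\ 64^-1 <= ar.1 <= expR 1, 0 < ar.2 < 1 & (N0 <= n)%N -> tuned n ar.1 ar.2].
  move=> n; have [Nn|Nn] := leqP N0 n.
    by have [a [rho [? ? ?]]] := tunedN n Nn; exists (a, rho).
  (* Values for small [n], within the same bounds so that these hold for every [n]. *)
  exists (1, 2^-1); split => //=.
    by have e2 := expR_ge1Dx (1 : R); apply/andP; split; lra.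
  by apply/andP; split; lra.
exists (fun n => (ar n).1), (fun n => (ar n).2).
have alpha_ge n : 64^-1 <= (ar n).1 by have [/andP[]] := arP n.
split.
- by move=> n; apply: lt_le_trans (alpha_ge n).
- split; last first.
    apply: (@le_lt_trans _ _ (expR 1)%:E); last exact: ltry.
    apply: (@limn_esup_le _ _ _ 0) => n _; rewrite lee_fin.
    by have [/andP[]] := arP n.
  apply/andP; split; last exact: limn_einf_sup.
  apply: (@lt_le_trans _ _ (64^-1)%:E); first by rewrite lte_fin.
  by apply: (@limn_einf_ge _ _ _ 0) => n _; rewrite lee_fin.
- by move=> n; have [] := arP n.
move=> kappa kappa_opt.
apply: (@lt_le_trans _ _ (400^-1 / 512)%:E); first by rewrite lte_fin divr_gt0.
apply: (@limn_einf_ge _ _ _ N0) => m Nm; rewrite lee_fin.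
have [_ /andP[rho0 rho1] /(_ (leqW (leqW Nm)))[k [k3 d324 kd dk rk]]] := arP m.+2.
apply: (@variance_lower_bound _ _ (vertex1 m) (vertex2 m) k); rewrite ?card_ord //.
- by rewrite !ltW.
- by move=> G1 G2; have [] := kappa_opt m G1 G2.
Qed.
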